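(* Let $A_s=U_s-\mathbf z_s\mathbf w_s^H\in\mathbb{C}^{n\times n}$, $s\ge 0$, be the matrices generated by the shifted QR iteration started from $A_0=\widehat C$, the permuted companion matrix of a polynomial of degree $n$, with $U_s,\mathbf z_s,\mathbf w_s$ as defined in the context. Then $$\operatorname{rank}\big(U_s(1:2j,\;2(j+1)+1:n)\big)\le 1,\qquad 1\le j\le \left\lfloor \tfrac{n+1}{2}\right\rfloor-2,\quad s\ge 0 .$$ Moreover, if $A_0$ is invertible, then $$U_s(1:2j,\;2(j+1)+1:n)=B_s(1:2j,\;2(j+1)+1:n),\qquad 1\le j\le \left\lfloor \tfrac{n+1}{2}\right\rfloor-2,\quad s\ge 0,$$ where $$B_s=\frac{U_s\mathbf w_s\mathbf z_s^HU_s}{\mathbf z_s^HU_s\mathbf w_s-1}\quad (s\ge 0),\qquad B_s=Q_{s-1}^HB_{s-1}Q_{s-1}\quad (s\ge 1),$$ is a rank one matrix.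
   Context: Notation: $M(a:b,\,c:d)$ is the submatrix of $M$ with rows $a,\dots,b$ and columns $c,\dots,d$; $M^H$ is the conjugate transpose; $e_1$ is the first standard basis vector; $I_n$ is the identity matrix. Initial matrix. Let $p(z)=p_0+p_1z+\dots+p_nz^n$ be a polynomial with $p_n\neq 0$. Its companion matrix $C\in\mathbb{C}^{n\times n}$ has first row $\left[-\frac{p_{n-1}}{p_n},-\frac{p_{n-2}}{p_n},\dots,-\frac{p_0}{p_n}\right]$, ones on the first subdiagonal (positions $(i+1,i)$, $1\le i\le n-1$) and zeros elsewhere. Then $C=U-e_1\mathbf p^H$, where $U$ is the cyclic permutation matrix with ones in positions $(1,n)$ and $(i+1,i)$, $1\le i\le n-1$, and zeros elsewhere, and $\mathbf p^H=\left[\frac{p_{n-1}}{p_n},\dots,\frac{p_1}{p_n},\frac{p_0}{p_n}+1\right]$. Let $\pi$ be the permutation of $\{1,\dots,n\}$ with $\pi(1)=1$, $\pi(2k)=k+1$, $\pi(2k+1)=n-k+1$ for $k\ge 1$, and let $P=(\delta_{i,\pi(j)})_{i,j}$ be the associated permutation matrix. Set $\widehat U=P^TUP$, $\widehat{\mathbf p}=P^T\mathbf p$ and $$A_0=\widehat C=P^TCP=\widehat U-e_1\widehat{\mathbf p}^H=U_0-\mathbf z_0\mathbf w_0^H,\qquad U_0=\widehat U,\ \mathbf z_0=e_1,\ \mathbf w_0=\widehat{\mathbf p}.$$ QR iteration. With shifts $\rho_s$, $s\ge0$: $A_s-\rho_sI_n=Q_sR_s$ with $Q_s$ unitary and $R_s$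 upper triangular, and $A_{s+1}=Q_s^HA_sQ_s$. Correspondingly $U_{s+1}=Q_s^HU_sQ_s$, $\mathbf z_{s+1}=Q_s^H\mathbf z_s$, $\mathbf w_{s+1}=Q_s^H\mathbf w_s$, so that $A_s=U_s-\mathbf z_s\mathbf w_s^H$ with $U_s$ unitary for all $s\ge0$.
   Formalization: If ρ_s is an eigenvalue of A_s, Q_s must be a limit of unitary QR factors of nonsingular A_s−ρ'I, ρ'→ρ_s (the claim fails for arbitrary Q_s, e.g. p=z^8, ρ_0=0); B_s has rank exactly one only when w_0≠0, since B_s=0 for p=p_n(z^n−1). *)

(* Defs.v *)
From HB Require Import structures.
From mathcomp Require Import all_boot all_order all_algebra.
From mathcomp Require Import reals complex.

Set Implicit Arguments.
Unset Strict Implicit.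
Unset Printing Implicit Defensive.

Import Order.TTheory GRing.Theory Num.Theory.

Local Open Scope ring_scope.
Local Open Scope complex_scope.
Local Open Scope sesquilinear_scope.

(* M(a:b, c:d) with 1-based inclusive bounds.  The rows and columns of the
   result are enumerated in increasing order (enum_val on ordinals); bounds
   that exceed the size of M are silently cut. *)
Definition irange (n a b : nat) : {set 'I_n} := [set i : 'I_n | a <= i.+1 <= b]%N.

Definition subblock (K : Type) (m n : nat) (M : 'M[K]_(m, n)) (a b c d : nat) :
    'M[K]_(#|irange m a b|, #|irange n c d|) :=
  mxsub (fun i => enum_val i) (fun j => enum_val j) M.

Section PermutedCompanion.
Context {R : realType}.
Local Notation C := R[i].
Variable n : nat.

(* Rows and columns are numbered from 0, so entry (i, j) of the text is entry
   (i - 1, j - 1) here. *)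
Definition companion (p : {poly C}) : 'M[C]_n :=
  \matrix_(i, j) if i == 0%N :> nat then - (p`_(n - j.+1) / p`_n)
                 else (i == j.+1 :> nat)%:R.

Definition cyclic_mx : 'M[C]_n :=
  \matrix_(i, j) ((i == j.+1 :> nat) || ((i == 0%N :> nat) && (j.+1 == n)))%:R.

Definition e1 : 'cV[C]_n := \col_i (i == 0%N :> nat)%:R.

(* The row vector p^H. *)
Definition pvecH (p : {poly C}) : 'rV[C]_n :=
  \row_j (p`_(n - j.+1) / p`_n + (j.+1 == n)%:R).

Definition pvec (p : {poly C}) : 'cV[C]_n := (pvecH p)^t*.

(* pi acts on 1, ..., n:
   pi(1) = 1, pi(2k) = k + 1, pi(2k + 1) = n - k + 1 for k >= 1. *)
Definition cmv_pi (j : nat) : nat :=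
  if j == 1%N then 1%N else if odd j then (n - j./2 + 1)%N else (j./2 + 1)%N.

Definition cmv_perm_mx : 'M[C]_n :=
  \matrix_(i, j) (i.+1 == cmv_pi j.+1 :> nat)%:R.

Definition companion_hat (p : {poly C}) : 'M[C]_n :=
  cmv_perm_mx^T *m companion p *m cmv_perm_mx.

Definition cyclic_hat : 'M[C]_n :=
  cmv_perm_mx^T *m cyclic_mx *m cmv_perm_mx.

Definition pvec_hat (p : {poly C}) : 'cV[C]_n := cmv_perm_mx^T *m pvec p.

Lemma companionE (p : {poly C}) :
  companion p = cyclic_mx - e1 *m (pvec p)^t*.
Proof.
rewrite /pvec trmxCK; apply/matrixP => i j; rewrite !mxE big_ord1 !mxE.
have [i0|i0] /= := eqVneq (i : nat) 0%N; last by rewrite orbF mul0r subr0.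
by rewrite i0 /= mul1r opprD addrCA subrr addr0.
Qed.

End PermutedCompanion.

Section QRStep.
Context {R : realType} {n : nat}.
Local Notation C := R[i].

Definition qr_factorization (M Q T : 'M[C]_n) : Prop :=
  [/\ Q \is unitarymx,
      (forall i j : 'I_n, (j < i)%N -> T i j = 0)
    & M = Q *m T].

(* One step with shift rho.  When rho is not an eigenvalue of A, (Q, T) is any
   QR factorization of A - rho I.  When rho is an eigenvalue, T has zeros on
   its diagonal and the matching columns of Q are not determined by
   A - rho I; an arbitrary choice of them can destroy the rank structure of
   the iterates.  In that case Q has to be a limit of unitary QR factors of
   the nonsingular matrices A - rho' I as rho' tends to rho.  Such a Q exists
   for every A and rho, because the unitary group is compact. *)
Definition qr_step (A : 'M[C]_n) (rho : C) (Q T : 'M[C]_n) : Prop :=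
  qr_factorization (A - rho%:M) Q T /\
  (A - rho%:M \notin unitmx ->
   forall eps : R, 0 < eps ->
   exists (rho' : C) (Q' T' : 'M[C]_n),
     [/\ `|rho' - rho| < eps%:C,
         A - rho'%:M \in unitmx,
         qr_factorization (A - rho'%:M) Q' T'
       & forall i j, `|Q' i j - Q i j| < eps%:C]).

Definition Bden (U : 'M[C]_n) (z w : 'cV[C]_n) : C :=
  (z^t* *m U *m w) 0 0 - 1.

Definition Bmx (U : 'M[C]_n) (z w : 'cV[C]_n) : 'M[C]_n :=
  (Bden U z w)^-1 *: (U *m w *m z^t* *m U).

End QRStep.

(* Main.v *)
(* For a < b the rank of the lower left block A_s(a+1:n, 1:b) cannot increase
   along the iteration: when A - rho I = QR is nonsingular, Q^H A Q = R A R^-1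
   with R upper triangular; at a singular shift Q is a limit of such factors
   and rank is lower semicontinuous.  With a = 2j and b = 2j + 2 this rank is
   initially at most 2, so it is at most 3 for the rank one perturbation
   U_s = A_s + z_s w_s^H.  By the nullity theorem applied to the unitary U_s,
   the block (b+1:n, 1:a) of U_s^-1 = U_s^H has rank at most 1.  If A_0 is
   invertible, the nullity theorem applied to A_s shows instead that the block
   (1:a, b+1:n) of A_s^-H vanishes, and A_s^-H = U_s - B_s. *)
Require Import Defs.
From mathcomp Require Import all_boot all_order all_algebra.
From mathcomp Require Import fingroup perm.
From mathcomp Require Import reals complex zify ring.

Set Implicit Arguments.
Unset Strict Implicit.
Unset Printing Implicit Defensive.

Import Order.TTheory GRing.Theory Num.Theory.

Local Open Scope ring_scope.
Local Open Scope complex_scope.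
Local Open Scope sesquilinear_scope.

(** * Nullity theorem and ranks of corner blocks *)

Section RankTools.
Context {K : fieldType}.

Lemma kermx_idempotent n (E : 'M[K]_n) :
  E *m E = E -> (kermx E :=: 1%:M - E)%MS.
Proof.
move=> EE; apply/eqmxP/andP; split; last first.
  by apply/sub_kermxP; rewrite mulmxBl mul1mx EE subrr.
apply/row_subP => i; set v := row i _.
have vE : v *m E = 0 by apply/sub_kermxP; exact: row_sub.
by apply/submxP; exists v; rewrite mulmxBr mulmx1 vE subr0.
Qed.

Lemma mxrank_capMr m1 m2 n (A : 'M[K]_(m1, n)) (B : 'M[K]_(m2, n)) (M : 'M_n) :
  M \in unitmx -> \rank ((A *m M) :&: (B *m M))%MS = \rank (A :&: B)%MS.
Proof.
move=> uM; apply/eqP; rewrite eqn_leq.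
have le p q (X : 'M[K]_(p, n)) (Y : 'M[K]_(q, n)) (N : 'M_n) : N \in unitmx ->
    (\rank (X :&: Y)%MS <= \rank (X *m N :&: Y *m N)%MS)%N.
  move=> uN; rewrite -(mxrankMfree (X :&: Y)%MS (B := N)) ?row_free_unit //.
  exact/mxrankS/capmxMr.
rewrite le // andbT -{2}(mulmxK uM A) -{2}(mulmxK uM B).
by apply: le; rewrite unitmx_inv.
Qed.

(* The nullity theorem, with complementary projections in place of
   complementary sets of rows and columns. *)
Lemma nullity_theorem n (E F M : 'M[K]_n) :
    E *m E = E -> F *m F = F -> M \in unitmx ->
  (\rank ((1%:M - F) *m invmx M *m E)%R + \rank (1%:M - E)%R =
   \rank ((1%:M - E) *m M *m F)%R + \rank (1%:M - F)%R)%N.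
Proof.
move=> EE FF uM.
have rkM (A N : 'M[K]_n) : N \in unitmx -> \rank (A *m N)%R = \rank A.
  by move=> uN; rewrite mxrankMfree // row_free_unit.
(* Rank-nullity for both products leaves the intersections of row spaces (I-F)M^-1 with I-E and
   (I-E)M with I-F; right multiplication by M carries the first to the second. *)
have := mxrank_mul_ker ((1%:M - F) *m invmx M) E.
have := mxrank_mul_ker ((1%:M - E) *m M) F.
rewrite (cap_eqmx (eqmx_refl _) (kermx_idempotent FF)).
rewrite (cap_eqmx (eqmx_refl _) (kermx_idempotent EE)).
rewrite -(mxrank_capMr ((1%:M - F) *m invmx M) _ uM) mulmxKV // capmxC.
rewrite (rkM _ M) // (rkM _ (invmx M)) ?unitmx_inv //; lia.
Qed.

(** Blocks are kept as n by n matrices padded with zeros: [pid_mx a] selects the first a coordinates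
    and [copid_mx a] the others. *)
Lemma nullity_theorem_corner n (a b : nat) (M : 'M[K]_n) :
    (a <= n)%N -> (b <= n)%N -> M \in unitmx ->
  (\rank (copid_mx b *m invmx M *m pid_mx a : 'M_n)%R + (n - a) =
   \rank (copid_mx a *m M *m pid_mx b : 'M_n)%R + (n - b))%N.
Proof.
move=> an bn uM.
have := @nullity_theorem n (pid_mx a) (pid_mx b) M.
by rewrite -!/(copid_mx _) !rank_copid_mx // !pid_mx_id //; apply.
Qed.

Lemma mxrank_invmx_corner n (a b c : nat) (M : 'M[K]_n) :
    (a <= b <= n)%N -> M \in unitmx ->
    (\rank (copid_mx a *m M *m pid_mx b : 'M_n)%R <= c + (b - a))%N ->
  (\rank (copid_mx b *m invmx M *m pid_mx a : 'M_n)%R <= c)%N.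
Proof.
move=> /andP[ab bn] uM; have := nullity_theorem_corner (leq_trans ab bn) bn uM.
lia.
Qed.

Lemma mxrank_corner_of_invmx n (a b : nat) (M : 'M[K]_n) :
    (a <= b <= n)%N -> M \in unitmx ->
    copid_mx b *m invmx M *m pid_mx a = 0 :> 'M_n ->
  (\rank (copid_mx a *m M *m pid_mx b : 'M_n)%R <= b - a)%N.
Proof.
move=> /andP[ab bn] uM M0; have := nullity_theorem_corner (leq_trans ab bn) bn uM.
rewrite M0 mxrank0; lia.
Qed.

Lemma mxrank_mxsub m n m' n' (f : 'I_m' -> 'I_m) (g : 'I_n' -> 'I_n)
  (M : 'M[K]_(m, n)) : (\rank (mxsub f g M) <= \rank M)%N.
Proof.
rewrite mxsubrc; apply: leq_trans (mxrankS (rowsub_sub _ _)) _.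
by rewrite -[M in colsub _ M]mulmx1 -mulmx_colsub mxrankM_maxl.
Qed.

Lemma mul_pid_mxE m n (a : nat) (M : 'M[K]_(m, n)) i j :
  (pid_mx a *m M) i j = M i j *+ (i < a)%N.
Proof.
rewrite mxE (bigD1 i) //= !mxE eqxx /= big1 ?addr0 ?mulr_natl // => k ki.
by rewrite mxE eq_sym (inj_eq val_inj) (negPf ki) mul0r.
Qed.

Lemma mul_copid_mxE m n (a : nat) (M : 'M[K]_(m, n)) i j :
  (copid_mx a *m M) i j = M i j *+ (a <= i)%N.
Proof.
rewrite mulmxBl mul1mx mxE [X in _ + X]mxE mul_pid_mxE.
by case: ltnP; rewrite ?subrr ?subr0.
Qed.

Lemma mulmx_pidE m n (a : nat) (M : 'M[K]_(m, n)) i j :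
  (M *m pid_mx a) i j = M i j *+ (j < a)%N.
Proof. by rewrite -[_ *m _]trmxK trmx_mul tr_pid_mx mxE mul_pid_mxE mxE. Qed.

Lemma mulmx_copidE m n (a : nat) (M : 'M[K]_(m, n)) i j :
  (M *m copid_mx a) i j = M i j *+ (a <= j)%N.
Proof.
rewrite mulmxBr mulmx1 mxE [X in _ + X]mxE mulmx_pidE.
by case: ltnP; rewrite ?subrr ?subr0.
Qed.

(** The 1-based column b+1 is the 0-based column b, where [copid_mx b] begins. *)
Lemma subblock_upper_right n (a b : nat) (M : 'M[K]_n) :
  subblock M 1 a b.+1 n =
  subblock (pid_mx a *m M *m copid_mx b : 'M_n) 1 a b.+1 n.
Proof.
apply/matrixP => i j; rewrite [LHS]mxE [RHS]mxE mulmx_copidE mul_pid_mxE.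
have := enum_valP i; have := enum_valP j.
by rewrite !inE ltnS => /andP[-> _] /= ->.
Qed.

Definition upper_triangular n (T : 'M[K]_n) : Prop :=
  forall i j : 'I_n, (j < i)%N -> T i j = 0.

Lemma upper_triangular_copid n (a : nat) (T : 'M[K]_n) : upper_triangular T ->
  copid_mx a *m T *m pid_mx a = 0 :> 'M_n.
Proof.
move=> upT; apply/matrixP => i j; rewrite mulmx_pidE mul_copid_mxE mxE.
case: ltnP => [ja|]; last by rewrite mulr0n.
by case: leqP => [ai|]; rewrite ?mul0rn // upT ?mul0rn ?(leq_trans ja).
Qed.

(** With equal cuts the nullity theorem equates the ranks of the lower left blocks of T and T^-1. *)
Lemma invmx_upper_triangular_copid n (a : nat) (T : 'M[K]_n) : (a <= n)%N ->
    upper_triangular T -> T \in unitmx ->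
  copid_mx a *m invmx T *m pid_mx a = 0 :> 'M_n.
Proof.
move=> an upT uT; apply/eqP; rewrite -mxrank_eq0.
have := nullity_theorem_corner an an uT.
by rewrite upper_triangular_copid // mxrank0 -[RHS]add0n => /addIn ->.
Qed.

(** Triangularity lets the projections be repeated on the inner sides of T and T^-1, so the block of
    T A T^-1 is the block of A with a factor on either side. *)
Lemma mxrank_lower_left_conj n (a b : nat) (T A : 'M[K]_n) : (b <= n)%N ->
    upper_triangular T -> T \in unitmx ->
  (\rank (copid_mx a *m (T *m A *m invmx T) *m pid_mx b : 'M_n)%R
   <= \rank (copid_mx a *m A *m pid_mx b : 'M_n)%R)%N.
Proof.
move=> bn upT uT.
have -> : copid_mx a *m (T *m A *m invmx T) *m pid_mx b =
    (copid_mx a *m T) *m (copid_mx a *m A *m pid_mx b)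
      *m (invmx T *m pid_mx b) :> 'M_n.
  have TE : copid_mx a *m T = copid_mx a *m T *m copid_mx a :> 'M_n.
    by rewrite mulmxBr mulmx1 upper_triangular_copid // subr0.
  have VE : invmx T *m pid_mx b = pid_mx b *m (invmx T *m pid_mx b) :> 'M_n.
    apply/eqP; rewrite -subr_eq0 -{1}[invmx T *m _]mul1mx -mulmxBl mulmxA.
    by rewrite invmx_upper_triangular_copid.
  by rewrite !mulmxA -TE -[RHS]mulmxA -[RHS]mulmxA -VE !mulmxA.
exact: leq_trans (mxrankM_maxl _ _) (mxrankM_maxr _ _).
Qed.

End RankTools.

(** * Continuity at a fixed matrix and lower semicontinuity of rank *)

Section Continuity.
Context {R : realType} {n : nat}.
Local Notation C := R[i].
Variable Q0 : 'M[C]_n.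

Definition mx_near (P : 'M[C]_n -> Prop) : Prop :=
  exists2 d : R, 0 < d &
    forall Q : 'M[C]_n, (forall i j, `|Q i j - Q0 i j| < d%:C) -> P Q.

Definition mx_continuous (f : 'M[C]_n -> C) : Prop :=
  forall e : C, 0 < e -> mx_near (fun Q => `|f Q - f Q0| < e).

Lemma mx_nearI (P P' P'' : 'M[C]_n -> Prop) :
    (forall Q, P Q -> P' Q -> P'' Q) ->
  mx_near P -> mx_near P' -> mx_near P''.
Proof.
move=> PP [d d0 dP] [d' d'0 d'P]; exists (Num.min d d').
  by rewrite lt_min d0.
move=> Q close; apply: PP; [apply: dP|apply: d'P] => i j;
  by apply: lt_le_trans (close i j) _; rewrite lecR ge_min lexx ?orbT.
Qed.

Lemma mx_continuous_ext (f g : 'M[C]_n -> C) :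
  f =1 g -> mx_continuous f -> mx_continuous g.
Proof.
move=> fg cf e /cf [d d0 dP]; exists d => // Q /dP; by rewrite !fg.
Qed.

Lemma mx_continuous_cst (c : C) : mx_continuous (fun=> c).
Proof. by move=> e e0; exists 1 => // Q _; rewrite subrr normr0. Qed.

Lemma mx_continuous_entry i j : mx_continuous (fun Q => Q i j).
Proof.
(* A positive complex number is real, so the real part of e serves as the radius. *)
move=> e e0; have Re_e : (complex.Re e)%:C = e by rewrite RRe_real // gtr0_real.
by exists (complex.Re e) => [|Q /(_ i j)]; rewrite ?Re_e // -ltcR Re_e.
Qed.

Lemma mx_continuous_conj f :
  mx_continuous f -> mx_continuous (fun Q => Num.conj (f Q)).
Proof.
move=> cf e /cf [d d0 dP]; exists d => // Q /dP.
by rewrite -rmorphB norm_conjC.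
Qed.

Lemma mx_continuousD f g : mx_continuous f -> mx_continuous g ->
  mx_continuous (fun Q => f Q + g Q).
Proof.
move=> cf cg e e0; have e20 : 0 < e / 2 by rewrite divr_gt0.
apply: mx_nearI (cf _ e20) (cg _ e20) => Q fQ gQ.
rewrite [e]splitr opprD addrACA; exact: le_lt_trans (ler_normD _ _) (ltrD fQ gQ).
Qed.

Lemma mx_continuousM f g : mx_continuous f -> mx_continuous g ->
  mx_continuous (fun Q => f Q * g Q).
Proof.
(* Adding 1 makes both bounds positive, hence valid divisors, and b also bounds |g Q| for Q near
   [Q0]. *)
move=> cf cg e e0; set a := `|f Q0| + 1; set b := `|g Q0| + 1.
have a0 : 0 < a by rewrite ltr_wpDl.
have b0 : 0 < b by rewrite ltr_wpDl.
have ea0 : 0 < e / 2 / a by rewrite !divr_gt0.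
have eb0 : 0 < e / 2 / b by rewrite !divr_gt0.
have near_g : mx_near (fun Q => `|g Q| < b /\ `|g Q - g Q0| < e / 2 / a).
  apply: mx_nearI (cg _ ltr01) (cg _ ea0) => Q gQ1 gQ; split=> //.
  rewrite -[g Q](subrK (g Q0)) /b addrC.
  by apply: le_lt_trans (ler_normD _ _) _; rewrite ltrD2l.
apply: mx_nearI (cf _ eb0) near_g => Q fQ [gQb gQ].
have -> : f Q * g Q - f Q0 * g Q0 = (f Q - f Q0) * g Q + f Q0 * (g Q - g Q0).
  by ring.
apply: le_lt_trans (ler_normD _ _) _; rewrite !normrM [e]splitr ltr_leD //.
  rewrite -(divfK (lt0r_neq0 b0) (e / 2)).
  exact: ltr_pM.
rewrite mulrC -(divfK (lt0r_neq0 a0) (e / 2)).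
by apply: ler_pM; rewrite // ?ltW // /a ltrDl.
Qed.

Lemma mx_continuous_sum (I : Type) (r : seq I) (F : I -> 'M[C]_n -> C) :
    (forall i, mx_continuous (F i)) ->
  mx_continuous (fun Q => \sum_(i <- r) F i Q).
Proof.
move=> cF; elim: r => [|i r IHr].
  by apply: mx_continuous_ext (mx_continuous_cst 0) => Q; rewrite big_nil.
by apply: mx_continuous_ext (mx_continuousD (cF i) IHr) => Q; rewrite big_cons.
Qed.

Lemma mx_continuous_prod (I : Type) (r : seq I) (F : I -> 'M[C]_n -> C) :
    (forall i, mx_continuous (F i)) ->
  mx_continuous (fun Q => \prod_(i <- r) F i Q).
Proof.
move=> cF; elim: r => [|i r IHr].
  by apply: mx_continuous_ext (mx_continuous_cst 1) => Q; rewrite big_nil.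
by apply: mx_continuous_ext (mx_continuousM (cF i) IHr) => Q; rewrite big_cons.
Qed.

Definition mxfun_continuous p q (F : 'M[C]_n -> 'M[C]_(p, q)) : Prop :=
  forall i j, mx_continuous (fun Q => F Q i j).

Lemma mxfun_continuous_cst p q (M : 'M[C]_(p, q)) : mxfun_continuous (fun=> M).
Proof. by move=> i j; exact: mx_continuous_cst. Qed.

Lemma mxfun_continuous_id : mxfun_continuous id.
Proof. by move=> i j; exact: mx_continuous_entry. Qed.

Lemma mxfun_continuousM p q r (F : 'M[C]_n -> 'M[C]_(p, q))
    (G : 'M[C]_n -> 'M[C]_(q, r)) :
  mxfun_continuous F -> mxfun_continuous G ->
  mxfun_continuous (fun Q => F Q *m G Q).
Proof.
move=> cF cG i j; apply: mx_continuous_ext; first by move=> Q; rewrite mxE.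
by apply: mx_continuous_sum => k; exact: mx_continuousM.
Qed.

Lemma mxfun_continuous_adj p q (F : 'M[C]_n -> 'M[C]_(p, q)) :
  mxfun_continuous F -> mxfun_continuous (fun Q => (F Q)^t*).
Proof.
move=> cF i j; apply: mx_continuous_ext; first by move=> Q; rewrite !mxE.
exact: mx_continuous_conj.
Qed.

Lemma mx_continuous_det p (F : 'M[C]_n -> 'M[C]_p) :
  mxfun_continuous F -> mx_continuous (fun Q => \det (F Q)).
Proof.
move=> cF; apply: mx_continuous_sum => s.
apply: mx_continuousM; first exact: mx_continuous_cst.
by apply: mx_continuous_prod => i; exact: cF.
Qed.

(** One-sided inverses X, Y of the factors of a rank factorization give X (F Q0) Y = I, of size the
    rank of F Q0. The determinant of X (F Q) Y is continuous and equals 1 at [Q0], so it stays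
    nonzero nearby and forces F Q to have at least that rank. *)
Lemma mxrank_lower_semicontinuous p q (F : 'M[C]_n -> 'M[C]_(p, q)) :
  mxfun_continuous F -> mx_near (fun Q => (\rank (F Q0) <= \rank (F Q))%N).
Proof.
move=> cF; set M := F Q0.
pose X := pinvmx (col_base M); pose Y := pinvmx (row_base M).
have XMY : X *m M *m Y = 1%:M.
  rewrite -[M in X *m M]mulmx_base.
  have -> : X *m (col_base M *m row_base M) *m Y
      = (X *m col_base M) *m (row_base M *m Y) by rewrite !mulmxA.
  by rewrite mulVpmx ?col_base_full // mul1mx mulmxVp ?row_base_free.
have cdet : mx_continuous (fun Q => \det (X *m F Q *m Y)).
  apply: mx_continuous_det; apply: mxfun_continuousM (mxfun_continuous_cst _).
  exact: mxfun_continuousM (mxfun_continuous_cst _) cF.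
have [d d0 dP] := cdet _ ltr01; exists d => // Q /dP; rewrite -/M XMY det1 => lt1.
have /mxrank_unit <- : X *m F Q *m Y \in unitmx.
  rewrite unitmxE unitfE; apply: contraTneq lt1 => ->.
  by rewrite sub0r normrN normr1 ltxx.
exact: leq_trans (mxrankM_maxl _ _) (mxrankM_maxr _ _).
Qed.

End Continuity.

(** * Conjugate transposes and unitary matrices *)

Section Adjoint.
Context {C : numClosedFieldType}.

Lemma adjmxM m n p (A : 'M[C]_(m, n)) (B : 'M[C]_(n, p)) :
  (A *m B)^t* = B^t* *m A^t*.
Proof. by rewrite trmx_mul map_mxM. Qed.

Lemma mxrank_adj m n (A : 'M[C]_(m, n)) : \rank (A^t*) = \rank A.
Proof. by rewrite mxrank_map mxrank_tr. Qed.

Lemma unitarymx_mulVmx n (Q : 'M[C]_n) : Q \is unitarymx -> Q^t* *m Q = 1%:M.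
Proof. by move=> /unitarymxP /mulmx1C. Qed.

Lemma unitarymx_invmx n (Q : 'M[C]_n) : Q \is unitarymx -> invmx Q = Q^t*.
Proof.
move=> uQ; rewrite -[RHS]mulmx1 -(mulmxV (unitarymx_unit uQ)) mulmxA.
by rewrite unitarymx_mulVmx // mul1mx.
Qed.

Lemma adj_upper_right n (a b : nat) (M : 'M[C]_n) :
  (pid_mx a *m M *m copid_mx b : 'M_n)^t* = copid_mx b *m M^t* *m pid_mx a.
Proof.
rewrite !adjmxM mulmxA linearB /= trmx1 !tr_pid_mx map_mxB map_mx1.
by rewrite !map_pid_mx.
Qed.

Lemma conj_unitarymx n (U Q : 'M[C]_n) :
  U \is unitarymx -> Q \is unitarymx -> Q^t* *m U *m Q \is unitarymx.
Proof. by move=> uU uQ; rewrite !mul_unitarymx ?trmxC_unitary. Qed.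

Lemma conj_rank_one_correction n (U Q : 'M[C]_n) (z w : 'cV[C]_n) :
  Q^t* *m (U - z *m w^t*) *m Q =
  Q^t* *m U *m Q - (Q^t* *m z) *m (Q^t* *m w)^t*.
Proof. by rewrite adjmxM trmxCK mulmxBr mulmxBl !mulmxA. Qed.

End Adjoint.

(** * Corner ranks under one QR step *)

Section QRInvariance.
Context {R : realType} {n : nat}.
Local Notation C := R[i].

Lemma qr_conjE (A Q T : 'M[C]_n) (rho : C) :
    qr_factorization (A - rho%:M) Q T -> A - rho%:M \in unitmx ->
  T \in unitmx /\ Q^t* *m A *m Q = T *m A *m invmx T.
Proof.
case=> uQ _ AE uA.
have uT : T \in unitmx by move: uA; rewrite AE unitmx_mul => /andP[].
split=> //; apply: (canRL (mulmxK uT)).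
(* Since A commutes with A - rho I, Q^H A Q T = Q^H A (A - rho I) = Q^H (A - rho I) A = T A. *)
have TE : T = Q^t* *m (A - rho%:M) by rewrite AE mulmxA unitarymx_mulVmx ?mul1mx.
rewrite -!mulmxA -AE [in RHS]TE -mulmxA; congr (_ *m _).
by rewrite mulmxBr mulmxBl scalar_mxC.
Qed.

Lemma qr_step_mxrank_lower_left (a b : nat) (A Q T : 'M[C]_n) (rho : C) :
    (b <= n)%N -> qr_step A rho Q T ->
  (\rank (copid_mx a *m (Q^t* *m A *m Q) *m pid_mx b : 'M_n)%R
   <= \rank (copid_mx a *m A *m pid_mx b : 'M_n)%R)%N.
Proof.
move=> bn [fQ limQ].
have regular (r : C) (Q' T' : 'M[C]_n) :
    qr_factorization (A - r%:M) Q' T' -> A - r%:M \in unitmx ->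
  (\rank (copid_mx a *m (Q'^t* *m A *m Q') *m pid_mx b : 'M_n)%R
   <= \rank (copid_mx a *m A *m pid_mx b : 'M_n)%R)%N.
  move=> fQ' uA; have [uT' ->] := qr_conjE fQ' uA.
  by case: fQ' => _ upT' _; exact: mxrank_lower_left_conj.
have [/(regular _ _ _ fQ) //|sing] := boolP (A - rho%:M \in unitmx).
pose F (X : 'M[C]_n) : 'M[C]_n := copid_mx a *m (X^t* *m A *m X) *m pid_mx b.
have cF : mxfun_continuous Q F.
  apply: mxfun_continuousM (mxfun_continuous_cst _ _).
  apply: mxfun_continuousM (mxfun_continuous_cst _ _) _.
  apply: mxfun_continuousM (mxfun_continuous_id _).
  apply: mxfun_continuousM (mxfun_continuous_cst _ _).
  exact: mxfun_continuous_adj (mxfun_continuous_id _).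
(* The semicontinuity radius d is used as the tolerance of the limit condition: it yields a factor
   Q' of a nonsingular shift at which the block rank is no smaller than at Q. *)
have [d d0 near] := mxrank_lower_semicontinuous cF.
have [r [Q' [T' [_ uA fQ' close]]]] := limQ sing d d0.
exact: leq_trans (near _ close) (regular _ _ _ fQ' uA).
Qed.

End QRInvariance.

(** * Rank one correction of a unitary matrix *)

Section RankOneCorrection.
Context {R : realType} {n : nat}.
Local Notation C := R[i].
Variables (A U : 'M[C]_n) (z w : 'cV[C]_n).
Hypotheses (unitaryU : U \is unitarymx) (AE : A = U - z *m w^t*).

Lemma mxrank_upper_right (a b : nat) : (a <= b <= n)%N ->
    (\rank (copid_mx a *m A *m pid_mx b : 'M_n)%R <= b - a)%N ->
  (\rank (pid_mx a *m U *m copid_mx b : 'M_n)%R <= 1)%N.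
Proof.
move=> abn rkA; rewrite -mxrank_adj adj_upper_right -unitarymx_invmx //.
apply: mxrank_invmx_corner => //; first exact: unitarymx_unit.
have -> : U = A + z *m w^t* by rewrite AE subrK.
rewrite mulmxDr mulmxDl; apply: leq_trans (mxrank_add _ _) _.
(* The rank one term z w^H raises the bound b - a by the 1 that becomes the rank bound for the block
   of U^H. *)
rewrite addnC leq_add // !mulmxA -mulmxA.
by apply: leq_trans (mxrankM_maxl _ _) (rank_leq_col _).
Qed.

Hypothesis unitA : A \in unitmx.

Let adjA : A^t* = U^t* - w *m z^t*.
Proof. by rewrite AE linearB /= map_mxB adjmxM trmxCK. Qed.

Let unit_adjA : A^t* \in unitmx.
Proof. by rewrite map_unitmx unitmx_tr. Qed.

Let scalarE : z^t* *m U *m w = (Bden U z w + 1)%:M.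
Proof. by rewrite subrK -mx11_scalar. Qed.

(** If z^H U w = 1, then z^H U A^H = z^H - z^H = 0, so z^H U = 0 because A^H is invertible, and then
    z^H U w = 0, a contradiction. *)
Lemma Bden_neq0 : Bden U z w != 0.
Proof.
apply/eqP => d0; have zUA : z^t* *m U *m A^t* = 0.
  rewrite adjA mulmxBr mulmxA scalarE d0 add0r mul1mx.
  by rewrite -mulmxA (unitarymxP unitaryU) mulmx1 subrr.
have zU0 : z^t* *m U = 0.
  by rewrite -[LHS]mulmx1 -(mulmxV unit_adjA) mulmxA zUA mul0mx.
have /matrixP/(_ 0 0)/eqP := scalarE.
by rewrite zU0 mul0mx d0 add0r !mxE eq_sym oner_eq0.
Qed.

(* Sherman-Morrison formula *)
Lemma invmx_adj : invmx (A^t*) = U - Bmx U z w.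
Proof.
have d0 := Bden_neq0; rewrite -[RHS]mulmx1 -(mulmxV unit_adjA) mulmxA.
suff -> : (U - Bmx U z w) *m A^t* = 1%:M by rewrite mul1mx.
rewrite adjA mulmxBl !mulmxBr (unitarymxP unitaryU) /Bmx -!scalemxAl.
have -> : U *m w *m z^t* *m U *m U^t* = U *m w *m z^t*.
  by rewrite -[LHS]mulmxA (unitarymxP unitaryU) mulmx1.
have -> : U *m w *m z^t* *m U *m (w *m z^t*)
    = (Bden U z w + 1) *: (U *m w *m z^t*).
  have -> : U *m w *m z^t* *m U *m (w *m z^t*)
    = U *m w *m (z^t* *m U *m w) *m z^t* by rewrite !mulmxA.
  by rewrite scalarE mul_mx_scalar scalemxAl.
(* With d = [Bden U z w], the coefficient 1 - (d + 1) = -d cancels the factor d^-1 of [Bmx]. *)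
rewrite -scalerBr -{1}[U *m w *m z^t*]scale1r -scalerBl opprD addrCA subrr addr0.
by rewrite scalerA mulrN mulVf // scaleN1r mulmxA opprK subrK.
Qed.

(** The difference U - B is the adjoint of A^-1, whose lower left block has rank at most 0 by the
    nullity bound with c = 0. *)
Lemma upper_right_Bmx (a b : nat) : (a <= b <= n)%N ->
    (\rank (copid_mx a *m A *m pid_mx b : 'M_n)%R <= b - a)%N ->
  pid_mx a *m U *m copid_mx b = pid_mx a *m Bmx U z w *m copid_mx b :> 'M_n.
Proof.
move=> abn rkA; apply/eqP; rewrite -subr_eq0 -mulmxBl -mulmxBr -invmx_adj.
rewrite -map_invmx -trmx_inv -mxrank_eq0 -mxrank_adj adj_upper_right trmxCK.
by rewrite -leqn0; apply: mxrank_invmx_corner.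
Qed.

End RankOneCorrection.

(** * Conjugation and rank of the correction B *)

Section Bconjugation.
Context {R : realType} {n : nat}.
Local Notation C := R[i].

Lemma Bmx_conj (U Q : 'M[C]_n) (z w : 'cV[C]_n) : Q \is unitarymx ->
  Bmx (Q^t* *m U *m Q) (Q^t* *m z) (Q^t* *m w) = Q^t* *m Bmx U z w *m Q.
Proof.
move=> /unitarymxP QQ; rewrite /Bmx /Bden adjmxM trmxCK.
have QK m (X : 'M[C]_(m, n)) : X *m Q *m Q^t* = X.
  by rewrite -mulmxA QQ mulmx1.
by rewrite !mulmxA !QK -scalemxAr -scalemxAl !mulmxA.
Qed.

Lemma mxrank_Bmx (U : 'M[C]_n) (z w : 'cV[C]_n) :
  (\rank (Bmx U z w) <= 1)%N.
Proof.
rewrite /Bmx -!mulmxA mulmxA scalemxAl.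
exact: leq_trans (mxrankM_maxl _ _) (rank_leq_col _).
Qed.

(** The nonzero scalar, the invertible U and the nonzero row z^H all preserve rank, which leaves the
    rank of w. *)
Lemma mxrank_Bmx_neq0 (U : 'M[C]_n) (z w : 'cV[C]_n) :
    U \in unitmx -> Bden U z w != 0 -> z != 0 -> w != 0 ->
  \rank (Bmx U z w) = 1%N.
Proof.
move=> uU d0 z0 w0; rewrite mxrank_scale_nz ?invr_eq0 //.
have rk1 m (v : 'cV[C]_m) : v != 0 -> \rank v = 1%N.
  by move=> v0; rewrite -mxrank_tr rank_rV trmx_eq0 v0.
rewrite mxrankMfree ?row_free_unit // mxrankMfree; last first.
  by rewrite /row_free mxrank_adj rk1.
by rewrite (eqmxMfull _ _) ?rk1 // row_full_unit.
Qed.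

End Bconjugation.

(** * Block structure of the permuted companion matrix *)

Section PermutedCompanionTheory.
Context {R : realType} {n : nat}.
Local Notation C := R[i].

(** The shifts pass between the 1-based [cmv_pi] and 0-based ordinals; the predecessor never
    truncates, as the values of [cmv_pi] are positive. *)
Let pi_ord (j : 'I_n) : ((cmv_pi n j.+1).-1 < n)%N.
Proof. by rewrite /cmv_pi; case: j => j /=; do ?case: ifP; lia. Qed.

Definition cmv_pi_ord (j : 'I_n) : 'I_n := Ordinal (pi_ord j).

Lemma cmv_pi_gt0 (j : nat) : (0 < cmv_pi n j)%N.
Proof. by rewrite /cmv_pi; do ?case: ifP; rewrite ?addn1. Qed.

Lemma cmv_pi_ordS (j : 'I_n) : (cmv_pi_ord j).+1 = cmv_pi n j.+1.
Proof. by rewrite /= prednK ?cmv_pi_gt0. Qed.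

Lemma cmv_pi_ord_inj : injective cmv_pi_ord.
Proof.
move=> i j /(congr1 (fun k : 'I_n => k.+1)); rewrite !cmv_pi_ordS /cmv_pi => eij.
by apply/val_inj; move: eij; case: i j => [i ltin] [j ltjn] /=;
  do ?case: ifP; lia.
Qed.

Definition cmv_perm : {perm 'I_n} := perm cmv_pi_ord_inj.

Definition cyclic_perm : {perm 'I_n} := perm (@ordS_inj n).

(** The ones of [perm_mx s] are at (i, s i), those of [cmv_perm_mx] at (s j, j); hence the
    transpose. *)
Lemma cmv_perm_mxE : cmv_perm_mx n = (perm_mx cmv_perm)^T :> 'M[C]_n.
Proof.
apply/matrixP => i j; rewrite !mxE permE -cmv_pi_ordS eqSS eq_sym.
by rewrite (inj_eq val_inj).
Qed.

Lemma cyclic_mxE : cyclic_mx n = (perm_mx cyclic_perm)^T :> 'M[C]_n.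
Proof.
apply/matrixP => i j; rewrite !mxE permE; congr (_%:R); congr nat_of_bool.
rewrite -(inj_eq val_inj) /=; have := ltn_ord j.
rewrite leq_eqVlt => /orP[/eqP jn|jn].
  by rewrite jn modnn eqxx andbT (ltn_eqF (ltn_ord i)) eq_sym.
by rewrite modn_small // (ltn_eqF jn) andbF orbF eq_sym.
Qed.

Lemma cyclic_hatE :
  cyclic_hat n
  = perm_mx (cmv_perm * cyclic_perm^-1 * cmv_perm^-1)%g :> 'M[C]_n.
Proof.
by rewrite /cyclic_hat cmv_perm_mxE cyclic_mxE trmxK !tr_perm_mx -!perm_mxM.
Qed.

Lemma perm_mx_unitary (s : {perm 'I_n}) : (perm_mx s : 'M[C]_n) \is unitarymx.
Proof.
by apply/unitarymxP; rewrite tr_perm_mx map_perm_mx -perm_mxM mulgV perm_mx1.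
Qed.

Lemma cyclic_hat_unitary : (cyclic_hat n : 'M[C]_n) \is unitarymx.
Proof. by rewrite cyclic_hatE perm_mx_unitary. Qed.

(** Entry (i, k) is 1 exactly when pi(i) is the cyclic successor of pi(k). For j >= 1 and 2j + 2 <=
    n, in 1-based terms, pi maps 1, ..., 2j onto the cyclic interval n-j+2, ..., n, 1, ..., j+1. The
    only new predecessor is n-j+1 = pi(2j+1), so the first 2j rows vanish beyond column 2j+1. *)
Lemma cyclic_hat_upper_right (j : nat) :
  pid_mx (2 * j) *m cyclic_hat n *m copid_mx (2 * j).+2 = 0 :> 'M[C]_n.
Proof.
apply/matrixP => i k; rewrite mulmx_copidE mul_pid_mxE [RHS]mxE.
rewrite !mulrb; have [jk|//] := leqP _ (val k); have [ij|//] := ltnP (val i) _.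
rewrite cyclic_hatE !mxE !permM.
have ne : cyclic_perm (cmv_perm k) != cmv_perm i.
  apply/eqP => /(congr1 val); rewrite !permE /= prednK ?cmv_pi_gt0 //.
  have : (cmv_pi n k.+1 <= n)%N by rewrite -cmv_pi_ordS.
  (* The successor wraps around exactly when pi(k) = n. *)
  rewrite leq_eqVlt => /orP[/eqP kn|kn]; [rewrite kn modnn | rewrite modn_small //];
    move: ij jk (ltn_ord i) (ltn_ord k) kn; rewrite /cmv_pi /=;
    case: i k => [i ?] [k ?] /=; do ?case: ifP; lia.
suff /negPf -> : (cmv_perm^-1 (cyclic_perm^-1 (cmv_perm i)))%g != k by [].
by apply: contra ne => /eqP <-; rewrite !permKV.
Qed.

Lemma cmv_perm_mx_adj : (cmv_perm_mx n : 'M[C]_n)^t* = (cmv_perm_mx n)^T.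
Proof. by rewrite cmv_perm_mxE trmxK map_perm_mx. Qed.

Lemma cmv_perm_mx_e1 : (cmv_perm_mx n)^T *m e1 n = e1 n :> 'cV[C]_n.
Proof.
apply/matrixP => i j; rewrite cmv_perm_mxE trmxK -row_permE !mxE permE /=.
by congr (_%:R); rewrite /cmv_pi; case: i => i /= ltin; do ?case: ifP; lia.
Qed.

Lemma e1_neq0 : (0 < n)%N -> e1 n != 0 :> 'cV[C]_n.
Proof.
move=> n0; apply/eqP => /matrixP/(_ (Ordinal n0) 0)/eqP.
by rewrite !mxE oner_eq0.
Qed.

Lemma companion_hatE (p : {poly C}) :
  companion_hat n p = cyclic_hat n - e1 n *m (pvec_hat n p)^t*.
Proof.
rewrite /companion_hat companionE mulmxBr mulmxBl; congr (_ - _).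
rewrite mulmxA cmv_perm_mx_e1 -mulmxA; congr (_ *m _).
rewrite /pvec_hat [RHS]adjmxM; congr (_ *m _).
by rewrite -cmv_perm_mx_adj trmxCK.
Qed.

(** As j >= 1, the selected rows miss the only nonzero entry of [e1], so only the unitary part
    remains. Its inverse is its adjoint, which has a zero lower left block, and the nullity theorem
    bounds the complementary block. *)
Lemma companion_hat_mxrank_lower_left (p : {poly C}) (j : nat) :
    (1 <= j)%N -> ((2 * j).+2 <= n)%N ->
  (\rank (copid_mx (2 * j) *m companion_hat n p *m pid_mx (2 * j).+2 : 'M_n)%R
    <= (2 * j).+2 - 2 * j)%N.
Proof.
move=> j1 jn; have uU := cyclic_hat_unitary.
have -> : copid_mx (2 * j) *m companion_hat n p = copid_mx (2 * j) *m cyclic_hat n.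
  rewrite companion_hatE mulmxBr [X in _ - X]mulmxA.
  suff -> : copid_mx (2 * j) *m e1 n = 0 :> 'cV[C]_n by rewrite mul0mx subr0.
  apply/matrixP => i k; rewrite mul_copid_mxE !mxE mulrb.
  by case: ifP => // ji; rewrite gtn_eqF // (leq_trans _ ji) // muln_gt0.
have ab : (2 * j <= (2 * j).+2 <= n)%N by rewrite jn andbT !leqW.
rewrite mxrank_corner_of_invmx ?unitarymx_unit //.
by rewrite unitarymx_invmx // -adj_upper_right cyclic_hat_upper_right trmx0 map_mx0.
Qed.

End PermutedCompanionTheory.

(** * Rank structure of all QR iterates *)

Theorem theorem3p3 (R : realType) (n : nat) (p : {poly R[i]})
    (rho : nat -> R[i]) (A U Q T : nat -> 'M[R[i]]_n)
    (z w : nat -> 'cV[R[i]]_n)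
    (size_p : size p = n.+1)
    (A0 : A 0%N = companion_hat n p)
    (U0 : U 0%N = cyclic_hat n)
    (z0 : z 0%N = e1 n)
    (w0 : w 0%N = pvec_hat n p)
    (QT : forall s, qr_step (A s) (rho s) (Q s) (T s))
    (AS : forall s, A s.+1 = (Q s)^t* *m A s *m Q s)
    (US : forall s, U s.+1 = (Q s)^t* *m U s *m Q s)
    (zS : forall s, z s.+1 = (Q s)^t* *m z s)
    (wS : forall s, w s.+1 = (Q s)^t* *m w s) :
  (forall s j : nat, (1 <= j <= n.+1./2 - 2)%N ->
     (\rank (subblock (U s) 1 (2 * j) (2 * (j + 1) + 1) n) <= 1)%N)
  /\
  (A 0%N \in unitmx ->
     [/\ forall s j : nat, (1 <= j <= n.+1./2 - 2)%N ->
           subblock (U s) 1 (2 * j) (2 * (j + 1) + 1) n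
           = subblock (Bmx (U s) (z s) (w s)) 1 (2 * j) (2 * (j + 1) + 1) n,
         forall s : nat, Bden (U s) (z s) (w s) != 0,
         forall s : nat, Bmx (U s.+1) (z s.+1) (w s.+1)
           = (Q s)^t* *m Bmx (U s) (z s) (w s) *m Q s,
         forall s : nat, (\rank (Bmx (U s) (z s) (w s)) <= 1)%N
       & w 0%N != 0 ->
           forall s : nat, \rank (Bmx (U s) (z s) (w s)) = 1%N]).

Proof.
have uQ s : Q s \is unitarymx by case: (QT s) => -[].
have uU s : U s \is unitarymx.
  by elim: s => [|s IHs]; [rewrite U0 cyclic_hat_unitary | rewrite US conj_unitarymx].
have AE s : A s = U s - z s *m (w s)^t*.
  elim: s => [|s IHs]; first by rewrite A0 U0 z0 w0 companion_hatE.
  by rewrite AS US zS wS IHs conj_rank_one_correction.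
(* With j >= 1 the natural subtraction does not truncate, so 2j + 4 <= n + 1. *)
have bound j : (1 <= j <= n.+1./2 - 2)%N -> (1 <= j)%N /\ ((2 * j).+2 <= n)%N.
  by lia.
have rkA s j : (1 <= j <= n.+1./2 - 2)%N ->
    (\rank (copid_mx (2 * j) *m A s *m pid_mx (2 * j).+2 : 'M_n)%R
     <= (2 * j).+2 - 2 * j)%N.
  move=> /bound[j1 jn].
  elim: s => [|s IHs]; first by rewrite A0 companion_hat_mxrank_lower_left.
  by rewrite AS; apply: leq_trans (qr_step_mxrank_lower_left _ jn (QT s)) IHs.
have blockE j (M : 'M[R[i]]_n) :
    subblock M 1 (2 * j) (2 * (j + 1) + 1) n
    = subblock (pid_mx (2 * j) *m M *m copid_mx (2 * j).+2 : 'M_n)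
        1 (2 * j) (2 * (j + 1) + 1) n.
  by rewrite mulnDr muln1 addn2 addn1 subblock_upper_right.
have abn j : (1 <= j <= n.+1./2 - 2)%N -> (2 * j <= (2 * j).+2 <= n)%N.
  by move=> /bound; lia.
split=> [s j hj|unitA0].
  rewrite blockE; apply: leq_trans (mxrank_mxsub _ _ _) _.
  have rk := mxrank_upper_right (uU s) (AE s) (abn j hj) (rkA s j hj).
  exact rk.
have unitA s : A s \in unitmx.
  elim: s => // s IHs; rewrite AS !unitmx_mul IHs.
  by rewrite !unitarymx_unit ?trmxC_unitary.
have d0 s : Bden (U s) (z s) (w s) != 0 by exact: Bden_neq0 (uU s) (AE s) (unitA s).
split=> [s j hj||s|s|w0n0 s] //.
- rewrite [LHS]blockE [RHS]blockE.
  by rewrite (upper_right_Bmx (uU s) (AE s) (unitA s) (abn j hj) (rkA s j hj)).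
- by rewrite US zS wS Bmx_conj.
- exact: mxrank_Bmx.
(* Multiplication by the unitary Q_s^H is injective, so nonzero vectors stay nonzero along the
   iteration. *)
have neq0 (v : nat -> 'cV[R[i]]_n) :
    (forall s, v s.+1 = (Q s)^t* *m v s) -> v 0%N != 0 -> v s != 0.
  move=> vS v0; elim: s => // s; apply: contra_neq => vs0.
  by rewrite -[v s]mul1mx -(unitarymxP (uQ s)) -mulmxA -vS vs0 mulmx0.
apply: mxrank_Bmx_neq0; [exact: unitarymx_unit | exact: d0 | | exact: neq0].
(* A nonzero entry of w_0 supplies an index in ['I_n], so n > 0 and [e1] is nonzero. *)
apply: neq0 => //; rewrite z0; have /cV0Pn[i _] := w0n0.
exact: e1_neq0 (leq_ltn_trans (leq0n _) (ltn_ord i)).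
Qed.
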